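(* Let $X$ be an $n$-normed linear space, let $b_2,\dots,b_n$ be fixed elements of $X$, and let $G$ be a finite dimensional subspace of $X$. Then for each $x\in X$ such that $\{x,b_2,\dots,b_n\}$ is linearly independent, there exists a best approximation to $x$ out of the elements of $G$ (with respect to $b_2,\dots,b_n$).
   Context: Let $n$ be a positive integer and $X$ a linear space over $\mathbb{K}$ ($=\mathbb{R}$ or $\mathbb{C}$) with $\dim X\ge n$. An $n$-norm on $X$ is a map $\|\cdot,\dots,\cdot\|:X^n\to\mathbb{R}$ such that, for all $x,y,x_1,\dots,x_n\in X$ and $\alpha\in\mathbb{K}$: (N1) $\|x_1,\dots,x_n\|=0$ if and only if $x_1,\dots,x_n$ are linearly dependent; (N2) $\|x_1,\dots,x_n\|$ is invariant under permutations of $x_1,\dots,x_n$; (N3) $\|\alpha x_1,x_2,\dots,x_n\|=|\alpha|\,\|x_1,\dots,x_n\|$; (N4) $\|x+y,x_2,\dots,x_n\|\le\|x,x_2,\dots,x_n\|+\|y,x_2,\dots,x_n\|$. Then $X$ is an $n$-normed linear space. For $G\subseteq X$, fixed $b_2,\dots,b_n\in X$ and $x\in X$ with $\{x,b_2,\dots,b_n\}$ linearly independent, put $\delta_b(x,G)=\inf_{g\in G}\|x-g,b_2,\dots,b_n\|$. A best approximation to $x$ out of the elements of $G$ is an element $g_0\in G$ with $\|x-g_0,b_2,\dots,b_n\|=\delta_b(x,G)$. *)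

(* Defs.v *)
From mathcomp Require Import all_boot all_order all_algebra perm.
From mathcomp Require Import classical_sets reals.
From mathcomp Require Import complex.

Set Implicit Arguments.
Unset Strict Implicit.
Unset Printing Implicit Defensive.

Import Order.TTheory GRing.Theory Num.Theory.
Local Open Scope classical_set_scope.
Local Open Scope ring_scope.

Variant scalar_kind := RealScalars | ComplexScalars.

Definition scalars (R : realType) (k : scalar_kind) : numFieldType :=
  match k with
  | RealScalars => R
  | ComplexScalars => R[i]
  end.

(* The norm of a numFieldType takes its values in the field itself; the
   modulus of a scalar is needed as an element of R for both fields. *)
Definition modulus (R : realType) (k : scalar_kind) : scalars R k -> R :=
  match k with
  | RealScalars => fun a : R => `|a|
  | ComplexScalars => fun a : R[i] => ComplexField.Normc.normc a
  end.

Section LinearDependence.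
Variables (K : fieldType) (X : lmodType K).

(* The predicate [free] of vector.v is restricted to finite dimensional
   spaces, hence the following definitions.  Dependence is that of the family:
   a tuple with a repeated entry is dependent. *)
Definition linearly_dependent n (t : n.-tuple X) : Prop :=
  exists2 a : 'I_n -> K,
    (exists i, a i != 0) & \sum_(i < n) a i *: tnth t i = 0.

Definition linearly_independent n (t : n.-tuple X) : Prop :=
  ~ linearly_dependent t.

Definition dim_at_least n : Prop :=
  exists t : n.-tuple X, linearly_independent t.

Definition finite_dimensional (G : {pred X}) : Prop :=
  exists d (e : d.-tuple X),
    (forall i, tnth e i \in G) /\
    (forall g, g \in G -> exists a : 'I_d -> K, g = \sum_(i < d) a i *: tnth e i).

End LinearDependence.

(* [nNorm X m] is the type of n-norms on X for n = m.+1, which accounts for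
   n >= 1. *)
Record nNorm (R : realType) (k : scalar_kind) (X : lmodType (scalars R k))
    (m : nat) := NNorm {
  nnorm :> m.+1.-tuple X -> R;
  nnorm_eq0 : forall t, nnorm t = 0 <-> linearly_dependent t;
  nnorm_perm : forall (s : 'S_m.+1) t,
    nnorm [tuple tnth t (s i) | i < m.+1] = nnorm t;
  nnormZ : forall (a : scalars R k) (x : X) (t : m.-tuple X),
    nnorm [tuple of a *: x :: t] = modulus a * nnorm [tuple of x :: t];
  nnormD : forall (x y : X) (t : m.-tuple X),
    nnorm [tuple of x + y :: t]
      <= nnorm [tuple of x :: t] + nnorm [tuple of y :: t]
}.

Section BestApproximation.
Variables (R : realType) (k : scalar_kind) (X : lmodType (scalars R k)).
Variables (m : nat) (N : nNorm X m) (b : m.-tuple X).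

Definition delta (x : X) (G : {pred X}) : R :=
  inf [set N [tuple of x - g :: b] | g in [set` G]].

Definition best_approximation (x : X) (G : {pred X}) (g0 : X) : Prop :=
  g0 \in G /\ N [tuple of x - g0 :: b] = delta x G.

End BestApproximation.

(* Main.v *)
Require Import Defs.
From mathcomp Require Import all_boot all_order all_algebra perm.
From mathcomp Require Import classical_sets reals.
From mathcomp Require Import boolp topology normedtype derive.
From mathcomp Require Import lra.
From mathcomp Require Import complex.

(** The map [y |-> ||y, b_2, ..., b_n||] is a seminorm, so it suffices to show
    that a finite dimensional subspace is proximinal for any seminorm [p].
    Adjoin generators one at a time: if [H] is proximinal, then the distance
    [q] to [H] is again a seminorm, and minimising [p] over [x + H + R e]
    amounts to minimising the Lipschitz function [a |-> q (x - a e)] over [R].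
    This function is constant if [q e = 0], and otherwise it is coercive, so
    that the extreme value theorem applies.  A complex line is the sum of the
    two real lines spanned by [e] and ['i e]. *)

Set Implicit Arguments.
Unset Strict Implicit.
Unset Printing Implicit Defensive.

Import Order.TTheory GRing.Theory Num.Theory.
Import numFieldNormedType.Exports.
Local Open Scope classical_set_scope.
Local Open Scope ring_scope.

(** * Minimisation of a function on the real line *)

Lemma lipschitz_coercive_min (R : realType) (f : R -> R) (L B : R) :
  (forall a b, f a <= f b + L * `|a - b|) ->
  (forall a, B <= `|a| -> f 0 <= f a) ->
  exists a0, forall a, f a0 <= f a.
Proof.
move=> fL fB.
have fcont : continuous f.
  move=> a; apply/cvgrPdist_le => eps eps0.
  (* No sign is assumed on [L], so the divisor is made positive by taking [|L| + 1]. *)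
  have L0 : 0 < `|L| + 1 by rewrite ltr_wpDl.
  near=> t.
  have dist_t : `|a - t| <= eps / (`|L| + 1).
    near: t; have /cvgrPdist_le : id @ a --> a by exact: cvg_id.
    by apply; rewrite divr_gt0.
  have LD : L * `|a - t| <= eps.
    rewrite ler_pdivlMr// in dist_t; apply: le_trans dist_t.
    rewrite mulrC ler_wpM2l//.
    by rewrite (le_trans (ler_norm L))// lerDl.
  rewrite ler_norml; have := fL a t; have := fL t a.
  rewrite [`|t - a|]distrC => h1 h2; apply/andP; split; lra.
(* With [|B|] in place of [B] the interval always contains 0, so its minimum is at most [f 0], which
   bounds [f] from below outside. *)
have le_CC : - `|B| <= `|B| by rewrite (le_trans (y := 0)) ?oppr_le0.
have [c _ fc] :=
  EVT_min le_CC (continuous_subspaceT fcont).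
exists c => a; have [aB|Ba] := leP `|a| `|B|.
  by apply: fc; rewrite in_itv/= -ler_norml.
apply: (le_trans (fc 0 _)).
  by rewrite in_itv/= oppr_le0 normr_ge0.
by apply: fB; rewrite (le_trans (ler_norm B))// ltW.
Unshelve. all: by end_near. Qed.

(** * Seminorms and proximinal subspaces over the reals *)

Section RealSeminorm.
(* [X] is regarded as a real vector space through [j]. *)
Variables (R : realType) (K : nzRingType) (j : {rmorphism R -> K}).
Variable X : lmodType K.
Implicit Types (p : X -> R) (H : set X).

Definition seminorm p : Prop :=
  (forall u v, p (u + v) <= p u + p v) /\
  (forall a u, p (j a *: u) = `|a| * p u).

Definition real_subspace H : Prop :=
  [/\ H 0, (forall u v, H u -> H v -> H (u + v))
    & (forall a u, H u -> H (j a *: u))].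

Definition proximinal p H : Prop :=
  forall x, exists2 g0, H g0 & forall g, H g -> p (x - g0) <= p (x - g).

Definition add_real_line H e : set X :=
  [set u | exists a h, H h /\ u = h + j a *: e].

Definition add_line H (e : X) : set X :=
  [set u | exists c h, H h /\ u = h + c *: e].

Lemma seminorm0 p : seminorm p -> p 0 = 0.
Proof. by move=> [_ pZ]; rewrite -(scaler0 X (j 0)) pZ normr0 mul0r. Qed.

Lemma seminormN p u : seminorm p -> p (- u) = p u.
Proof.
move=> [_ pZ].
by rewrite -scaleN1r -(rmorph1 j) -rmorphN pZ normrN1 mul1r.
Qed.

(** This follows from [0 = p (u - u) <= p u + p u]. *)
Lemma seminorm_ge0 p u : seminorm p -> 0 <= p u.
Proof.
move=> sp; have [pD _] := sp.
have := pD u (- u); rewrite subrr seminorm0// seminormN// => ?; lra.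
Qed.

Lemma seminorm_min_line p x e : seminorm p ->
  exists a0, forall a, p (x - j a0 *: e) <= p (x - j a *: e).
Proof.
move=> sp; have [pD pZ] := sp.
have lip a b : p (x - j a *: e) <= p (x - j b *: e) + p e * `|a - b|.
  have -> : x - j a *: e = (x - j b *: e) + j (b - a) *: e.
    by rewrite rmorphB scalerBl addrA subrK.
  by rewrite (le_trans (pD _ _))// pZ distrC mulrC.
have [pe0|pe_neq0] := eqVneq (p e) 0.
  exists 0 => a; rewrite (le_trans (lip 0 a))// pe0; lra.
have pe_gt0 : 0 < p e by rewrite lt_def pe_neq0 seminorm_ge0.
(* The threshold comes from the reverse triangle inequality: if [|a| * p e] is at least [2 * p x],
   then [p (x - j a *: e) >= |a| * p e - p x >= p x], the value at 0. *)
apply: (lipschitz_coercive_min (f := fun a => p (x - j a *: e)) lip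
  (B := (p x + p x) / p e)) => a.
rewrite ler_pdivrMr// -pZ => large; rewrite rmorph0 scale0r subr0.
have := pD (x - j a *: e) (- x).
rewrite addrAC subrr sub0r !(seminormN _ sp).
by move=> ?; lra.
Qed.

Lemma real_subspace_add_line H e :
  real_subspace H -> real_subspace (add_real_line H e).
Proof.
move=> [H0 HD HZ]; split.
- by exists 0, 0; rewrite rmorph0 scale0r addr0.
- move=> _ _ [a [h [Hh ->]]] [b [h' [Hh' ->]]].
  by exists (a + b), (h + h'); split; [exact: HD|rewrite rmorphD scalerDl addrACA].
- move=> c _ [a [h [Hh ->]]]; exists (c * a), (j c *: h); split; first exact: HZ.
  by rewrite scalerDr scalerA rmorphM.
Qed.

(** The selection [P] need not be linear. It suffices that [P u + P v] and [j a *: P u] lie in [H]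
    and so compete with the best choices for [u + v] and [j a *: u]. *)
Lemma seminorm_dist p H (P : X -> X) : seminorm p -> real_subspace H ->
  (forall x, H (P x)) -> (forall x g, H g -> p (x - P x) <= p (x - g)) ->
  seminorm (fun x => p (x - P x)).
Proof.
move=> sp [H0 HD HZ] HP Pmin; have [pD pZ] := sp.
have le_qZ a u : p (j a *: u - P (j a *: u)) <= `|a| * p (u - P u).
  rewrite (le_trans (Pmin _ _ (HZ a _ (HP u))))//.
  by rewrite -scalerBr pZ.
split=> [u v|a u].
  rewrite (le_trans (Pmin _ _ (HD _ _ (HP u) (HP v))))//.
  by rewrite opprD addrACA pD.
apply/eqP; rewrite eq_le le_qZ/=.
have [->|a0] := eqVneq a 0; first by rewrite normr0 mul0r seminorm_ge0.
(* The reverse inequality is [le_qZ] for the scalar [a^-1] at the vector [j a *: u]. *)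
rewrite -ler_pdivlMl ?normr_gt0// -normfV.
by have := le_qZ a^-1 (j a *: u); rewrite scalerA -rmorphM mulVf// rmorph1 scale1r.
Qed.

Lemma proximinal_add_real_line p H e : seminorm p -> real_subspace H ->
  proximinal p H -> proximinal p (add_real_line H e).
Proof.
move=> sp HH pH.
have /boolp.choice[P PP] : forall x, exists g0,
    H g0 /\ forall g, H g -> p (x - g0) <= p (x - g).
  by move=> x; have [g0] := pH x; exists g0.
have HP x : H (P x) by have [] := PP x.
have Pmin x g : H g -> p (x - P x) <= p (x - g) by have [_] := PP x; exact.
move=> x.
have [a0 min_a0] := seminorm_min_line x e (seminorm_dist sp HH HP Pmin).
(* First the coefficient on [e] that brings [x - j a *: e] closest to [H] is fixed, then the
   remainder is approximated within [H]. *)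
exists (P (x - j a0 *: e) + j a0 *: e).
  by exists a0, (P (x - j a0 *: e)).
move=> _ [a [h [Hh ->]]].
rewrite [_ + j a0 *: e]addrC [h + _]addrC !opprD !addrA.
by rewrite (le_trans (min_a0 a))// Pmin.
Qed.

End RealSeminorm.

(** * Real and complex scalars, and the span of finitely many vectors *)

Definition real_scalar (R : realType) (k : scalar_kind) :
    {rmorphism R -> scalars R k} :=
  match k with
  | RealScalars => idfun
  | ComplexScalars => real_complex R
  end.

Lemma modulus_real_scalar (R : realType) k (a : R) :
  modulus (real_scalar R k a) = `|a|.
Proof.
case: k => //=.
by rewrite /ComplexField.Normc.normc /= expr0n addr0 sqrtr_sqr.
Qed.

Section ScalarLines.
Variables (R : realType) (k : scalar_kind) (X : lmodType (scalars R k)).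
Implicit Types (p : X -> R) (H : set X).
Let j := real_scalar R k.

(** The subspace property is carried along because adjoining the next line requires it. *)
Lemma proximinal_add_line p H e :
  seminorm j p -> real_subspace j H -> proximinal p H ->
  real_subspace j (add_line H e) /\ proximinal p (add_line H e).
Proof.
rewrite {}/j; case: k X p H e => X' p H e sp HH pH.
  (* Here [j] is the identity, so [add_line] and [add_real_line] are convertible. *)
  split; first exact: (real_subspace_add_line e HH).
  exact: (proximinal_add_real_line e sp HH pH).
pose jC := real_complex R : {rmorphism R -> R[i]}.
have -> : add_line H e =
    add_real_line jC (add_real_line jC H e) (('i%C : R[i]) *: e).
  apply/seteqP; split => u.
  - move=> [[a b] [h [Hh ->]]].
    exists b, (h + jC a *: e); split; first by exists a, h.
    rewrite -addrA scalerA -scalerDl; congr (_ + _ *: _).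
    by rewrite [LHS]complexE mulrC.
  - move=> [b [_ [[a [h [Hh ->]]] ->]]].
    exists (jC a + jC b * 'i%C), h; split=> //.
    by rewrite -addrA scalerA -scalerDl.
have HH' := real_subspace_add_line e HH.
split; first exact: real_subspace_add_line.
apply: proximinal_add_real_line => //.
exact: proximinal_add_real_line.
Qed.

(** Built by successive lines, so that induction on the list adjoins one generator at a time. *)
Definition lspan (s : seq X) : set X := foldr (fun e H => add_line H e) [set 0] s.

Lemma proximinal_lspan p s : seminorm j p -> proximinal p (lspan s).
Proof.
move=> sp; suff [] : real_subspace j (lspan s) /\ proximinal p (lspan s) by [].
elim: s => [|e s [HH pH]] /=; last exact: proximinal_add_line.
split; last by move=> x; exists 0 => // g ->.
split=> // [u v -> ->|a u ->]; first exact: addr0.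
exact: scaler0.
Qed.

Lemma lspan_sub (G : submodClosed X) s :
  {subset s <= G} -> lspan s `<=` [set` G].
Proof.
elim: s => [|e s IHs] sG u /=; first by move=> ->; exact: rpred0.
move=> [c [h [sh ->]]]; apply: rpredD.
  by apply: (IHs _ _ sh) => v vs; apply: sG; rewrite inE vs orbT.
by apply: rpredZ; apply: sG; rewrite mem_head.
Qed.

Lemma lspan_sum d (t : d.-tuple X) (a : 'I_d -> scalars R k) :
  lspan t (\sum_(i < d) a i *: tnth t i).
Proof.
elim: d t a => [|d IHd] t a; first by rewrite tuple0 big_ord0.
case/tupleP: t => e t; rewrite big_ord_recl tnth0.
exists (a ord0), (\sum_(i < d) a (lift ord0 i) *: tnth t i); split.
  exact: IHd.
by rewrite addrC; congr (_ + _); apply: eq_bigr => i _; rewrite tnthS.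
Qed.

Lemma finite_dimensional_proximinal p (G : submodClosed X) :
  seminorm j p -> finite_dimensional G -> proximinal p [set` G].
Proof.
move=> sp [d [t [tG Gt]]] x.
(* The span of [t] is [G]: one inclusion puts the minimiser in [G], the other makes every element of
   [G] a competitor. *)
have [g0 tg0 g0min] := proximinal_lspan t sp x.
exists g0.
  by apply: lspan_sub tg0 => _ /tnthP[i ->].
by move=> g /Gt[a ->]; apply/g0min/lspan_sum.
Qed.

Lemma nNorm_seminorm m (N : nNorm X m) (b : m.-tuple X) :
  seminorm j (fun y => N [tuple of y :: b]).
Proof.
split=> [u v|a u]; first exact: nnormD.
by rewrite nnormZ modulus_real_scalar.
Qed.

End ScalarLines.

Theorem theorem3p1 (R : realType) (k : scalar_kind)
    (X : lmodType (scalars R k)) (m : nat) (dimX : dim_at_least X m.+1)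
    (N : nNorm X m) (b : m.-tuple X)
    (G : submodClosed X) (finG : finite_dimensional G) (x : X)
    (indep_xb : linearly_independent [tuple of x :: b]) :
  exists g0 : X, best_approximation N b x G g0.
Proof.
have [g0 Gg0 g0min] :=
  finite_dimensional_proximinal (nNorm_seminorm N b) finG x.
(* The value at [g0] is both a lower bound and a member of the set of values, hence its infimum. *)
exists g0; split=> //; apply/eqP; rewrite eq_le; apply/andP; split.
  apply: lb_le_inf; first by exists (N [tuple of x - g0 :: b]), g0.
  by move=> _ [g Gg <-]; exact: g0min.
apply: ge_inf; last by exists g0.
by exists (N [tuple of x - g0 :: b]) => _ [g Gg <-]; exact: g0min.
Qed.
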